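(* Let $p$ be an odd prime, $m\ge 6$ an integer, $q=p^m$, and let $l$ be an integer with $1\le l\le m-1$ and $l\notin\{\frac m6,\frac m4,\frac m2,\frac{3m}4,\frac{5m}6\}$; assume $m\neq 3\gcd(m,l)$. Let $$\mathcal D=\{(\mathrm{Tr}(ax^{p^{3l}+1}+bx^{p^l+1}+cx)+h)_{x\in\mathbb F_q}: a,b,c\in\mathbb F_q,\ h\in\mathbb F_p\}\subseteq\mathbb F_p^{\,q}.$$ For every $i>0$ such that $\mathcal D$ contains a codeword of weight $i$, the supports of all codewords of weight $i$ in $\mathcal D$ form the block set of a $2$-design on the point set $\mathbb F_q$.
   Context: $\mathrm{Tr}$ is the trace map from $\mathbb F_q$ to $\mathbb F_p$. The support of a codeword $(c_x)_{x\in\mathbb F_q}$ is $\{x\in\mathbb F_q: c_x\neq0\}$ and its weight is the size of its support. A $2$-$(v,k,\lambda)$ design is a pair $(\mathcal P,\mathcal B)$ with $|\mathcal P|=v$ and $\mathcal B$ a collection of $k$-subsets (blocks) of $\mathcal P$ such that every set of two distinct points lies in exactly $\lambda$ blocks, $\lambda$ a positive integer; here $\mathcal B$ is the set of distinct supports (no repeated blocks), and the trivial case $k=v$ is allowed. The code $\mathcal D$ is the one the paper denotes $\overline{\mathbb C^{\bot}}^{\bot}$. *)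

(* Defs.v *)
From mathcomp Require Import all_boot all_order all_algebra all_fingroup.
From mathcomp Require Import all_solvable all_field.

Set Implicit Arguments.
Unset Strict Implicit.
Unset Printing Implicit Defensive.

Import GRing.Theory.
Local Open Scope ring_scope.

Section Trace.

Variables (F : finFieldType) (p : nat) (charFp : p \in [pchar F]).

(* [F] regarded as a Galois extension of ['F_p]. *)
Local Notation L := (pPrimeCharType charFp).

(* [galTrace] takes its values in [L]; these lie in the prime subfield, and
   [trace x] is the corresponding scalar, as [traceE] certifies, so that the
   default value [0] is never used. *)
Definition trace (x : F) : 'F_p :=
  odflt 0 [pick t : 'F_p | t%:A == galTrace 1 {:L} (x : L)].

Lemma traceE (x : F) : (trace x)%:A = galTrace 1 {:L} (x : L).
Proof.
rewrite /trace; case: pickP => [t /eqP //|] no_t.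
have galL : galois 1 {:L} by apply: finField_galois; apply: sub1v.
have /vlineP[t Dt] := mem_galTrace galL (memvf (x : L)).
by have := no_t t; rewrite -Dt eqxx.
Qed.

Lemma trace_sum (m : nat) (cardF : #|F| = (p ^ m)%N) (x : F) :
  (trace x)%:R = \sum_(i < m) x ^+ (p ^ i).
Proof.
have p_pr := pcharf_prime charFp.
transitivity ((trace x)%:A : L); first by rewrite -[LHS]mulr1.
rewrite traceE /galTrace.
have [al gal Dal] := @finField_galois_generator _ L 1%AS {:L}%AS (sub1v _).
have Dal1 (y : L) : al y = y ^+ p.
  by rewrite Dal ?memvf ?dimv1 ?expn1 ?card_Fp.
have oal : #[al]%g = m.
  rewrite orderE -(eqP gal) -galois_dim ?finField_galois ?sub1v //.
  by rewrite dimv1 divn1 pprimeChar_dimf /= [#|_|]cardF pfactorK.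
have -> : 'Gal({:L} / 1)%g = <[al]>%g by apply/eqP.
rewrite (eq_bigl (mem (traject ( *%g al) 1%g #[al]%g))); last first.
  by move=> y; apply: cycle_traject.
rewrite -big_uniq; last first.
  by apply/card_uniqP; rewrite size_traject -(eq_card (cycle_traject al)).
have -> : traject ( *%g al) 1%g #[al]%g
            = [seq iter i ( *%g al) 1%g | i <- iota 0 #[al]%g].
  apply: (@eq_from_nth _ 1%g) => [|i].
    by rewrite size_traject size_map size_iota.
  rewrite size_traject => lti.
  by rewrite nth_traject // (nth_map 0%N) ?size_iota // nth_iota.
rewrite oal big_map -(big_mkord xpredT (fun i => x ^+ (p ^ i))).
rewrite /index_iota subn0; apply: eq_bigr => i _ /=.
have -> : iter i ( *%g al) 1%g = (al ^+ i)%g.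
  by elim: i => [//|i IH]; rewrite iterS IH expgS.
elim: i => [|i IH]; first by rewrite expg0 gal_id expn0 expr1.
by rewrite expgSr galM ?memvf // IH Dal1 expnSr exprM.
Qed.

End Trace.

Section Codes.

Variables (K : finFieldType) (X : finType).
Implicit Types (u : {ffun X -> K}) (C : {set {ffun X -> K}}).

Definition codeword_support u : {set X} := [set x | u x != 0].

Definition weight u : nat := #|codeword_support u|.

(* A set of blocks: codewords sharing a support contribute it only once. *)
Definition weight_supports C (i : nat) : {set {set X}} :=
  [set codeword_support u | u in C & weight u == i].

End Codes.

Definition is_2design (X : finType) (v k lambda : nat) (B : {set {set X}}) :=
  [/\ #|X| = v,
      forall b : {set X}, b \in B -> #|b| = k,
      (0 < lambda)%N
    & forall x y : X, x != y ->
        #|[set b in B | (x \in b) && (y \in b)]| = lambda].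

Definition code_D (F : finFieldType) (p : nat) (charFp : p \in [pchar F])
    (l : nat) : {set {ffun F -> 'F_p}} :=
  [set [ffun x : F =>
          let: (a, b, c, h) := abch in
          trace charFp (a * x ^+ (p ^ (3 * l) + 1)
                        + b * x ^+ (p ^ l + 1) + c * x) + h]
     | abch : F * F * F * 'F_p].

(* Main.v *)
From HB Require Import structures.
Require Import Defs.
From mathcomp Require Import all_boot all_order all_algebra all_fingroup.
From mathcomp Require Import all_solvable all_field.
From mathcomp Require Import ring.

Set Implicit Arguments.
Unset Strict Implicit.
Unset Printing Implicit Defensive.

Import GRing.Theory.
Local Open Scope ring_scope.

(* Substituting [s * x + t] for [x] in [a x^(p^k + 1)] creates, besides
   [a s^(p^k + 1) x^(p^k + 1)], only a constant and the terms [d x] and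
   [e x^(p^k)], and [Tr (e x^(p^k))] is again of the form [Tr (c x)].  Hence
   the code is invariant under the affine group of the field, which acts
   doubly transitively on the points.  The supports of a given weight [i] thus
   form a 2-design once [i >= 2].  Weight [1] does not occur: every codeword
   has degree at most 2, hence satisfies a parallelogram identity that a
   function vanishing everywhere but at one point violates. *)

Section AffineInvariantDesign.

Variable F : finFieldType.

Section Blocks.

Variable B : {set {set F}}.
Hypothesis affB : forall (s t : F) (b : {set F}), s != 0 -> b \in B ->
  (fun x => s * x + t) @^-1: b \in B.

(** Preimage under the affine map taking [x'], [y'] to [x], [y] injects the blocks through [x], [y]
    into those through [x'], [y']. Exchanging the two pairs then gives equality of the counts. *)
Lemma leq_card_blocks_through2 (x y x' y' : F) : x != y -> x' != y' ->
  (#|[set b in B | (x \in b) && (y \in b)]|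
     <= #|[set b in B | (x' \in b) && (y' \in b)]|)%N.
Proof.
move=> neq_xy neq_xy'.
have dxy : x - y != 0 by rewrite subr_eq0.
have dxy' : x' - y' != 0 by rewrite subr_eq0.
pose s := (x - y) / (x' - y'); pose t := x - s * x'.
have s0 : s != 0 by rewrite mulf_neq0 ?invr_eq0.
have phix : s * x' + t = x by rewrite /t; ring.
have phiy : s * y' + t = y.
  have -> : s * y' + t = x - s * (x' - y') by rewrite /t; ring.
  by rewrite divfK // subKr.
have inj_pre : injective (fun b : {set F} => (fun z => s * z + t) @^-1: b).
  move=> b b' /setP eq_bb'; apply/setP=> z; have := eq_bb' (s^-1 * (z - t)).
  by rewrite !inE mulVKf // subrK.
rewrite -(card_imset _ inj_pre); apply/subset_leq_card/subsetP=> _ /imsetP[b + ->].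
by rewrite inE => /and3P[bB xb yb]; rewrite inE affB // !inE phix phiy xb yb.
Qed.

Lemma affine_invariant_2design (i : nat) (b0 : {set F}) :
  (forall b, b \in B -> #|b| = i) -> b0 \in B -> (1 < #|b0|)%N ->
  exists lambda, is_2design #|F| i lambda B.
Proof.
move=> cardB b0B /card_gt1P[x [y [xb yb neq_xy]]].
exists #|[set b in B | (x \in b) && (y \in b)]|; split=> // [|x' y' neq_xy'].
  by apply/card_gt0P; exists b0; rewrite inE b0B xb yb.
by apply/eqP; rewrite eqn_leq !leq_card_blocks_through2.
Qed.

End Blocks.

(** The preimage of the support of [u] is the support of [u] composed with the affine map, and
    bijectivity keeps the weight. *)
Lemma weight_supports_affine (K : finFieldType) (C : {set {ffun F -> K}})
    (i : nat) :
  (forall (s t : F) u, s != 0 -> u \in C ->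
     [ffun x => u (s * x + t)] \in C) ->
  forall (s t : F) b, s != 0 -> b \in weight_supports C i ->
    (fun x => s * x + t) @^-1: b \in weight_supports C i.
Proof.
move=> affC s t _ s0 /imsetP[u + ->]; rewrite inE => /andP[uC /eqP wu].
have pre_supp : (fun x => s * x + t) @^-1: codeword_support u
    = codeword_support [ffun x => u (s * x + t)].
  by apply/setP=> x; rewrite !inE ffunE.
rewrite pre_supp; apply: imset_f; rewrite inE affC //= -wu.
rewrite /weight -pre_supp; apply/eqP.
apply: on_card_preimset; exists (fun z => s^-1 * (z - t)) => z _ /=.
  by rewrite addrK mulKf.
by rewrite mulVKf // subrK.
Qed.

End AffineInvariantDesign.

Section Code.

Variables (F : finFieldType) (p : nat) (charFp : p \in [pchar F]).
Variable m : nat.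
Hypothesis cardF : #|F| = (p ^ m)%N.
Local Notation tr := (trace charFp).

Lemma trace_is_zmod_morphism : zmod_morphism tr.
Proof.
move=> x y; apply: (fmorph_inj (in_alg (pPrimeCharType charFp))) => /=.
rewrite scalerBl !traceE; exact: raddfB.
Qed.

HB.instance Definition _ :=
  GRing.isZmodMorphism.Build F 'F_p tr trace_is_zmod_morphism.

Lemma exprDpk (k : nat) (x y : F) :
  (x + y) ^+ (p ^ k) = x ^+ (p ^ k) + y ^+ (p ^ k).
Proof. by rewrite exprDn_pchar // pnatX pnatE ?(pcharf_prime charFp) ?charFp. Qed.

(** Seen in [F], the trace is the sum of the conjugates [x ^+ (p ^ i)], which Frobenius permutes
    cyclically because [x ^+ (p ^ m) = x]. *)
Lemma trace_frob (x : F) : tr (x ^+ p) = tr x.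
Proof.
apply: (fmorph_inj (in_alg (pPrimeCharType charFp))) => /=.
have E (y : F) : (tr y)%:A = \sum_(i < m) y ^+ (p ^ i) :> pPrimeCharType charFp.
  by rewrite -(trace_sum charFp cardF) -[RHS]mulr1.
rewrite !E; case: m cardF => [|n] cardFn; first by rewrite !big_ord0.
rewrite big_ord_recr [RHS]big_ord_recl /= addrC expn0 expr1.
rewrite -exprM -expnS -cardFn expf_card; congr (_ + _).
by apply: eq_bigr => i _; rewrite -exprM -expnS.
Qed.

Lemma trace_frobX (k : nat) (x : F) : tr (x ^+ (p ^ k)) = tr x.
Proof. by elim: k => [|k IH]; rewrite ?expr1 // expnSr exprM trace_frob. Qed.

(** An injective Frobenius power on a finite field is onto, so [d] is [e ^+ (p ^ k)] for some [e],
    and the trace does not distinguish [(e * x) ^+ (p ^ k)] from [e * x]. *)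
Lemma trace_adjoint_frobX (k : nat) (d : F) :
  exists e, forall x, tr (d * x ^+ (p ^ k)) = tr (e * x).
Proof.
have inj_frob : injective (fun x : F => x ^+ (p ^ k)).
  move=> x y /= eq_xy; apply/eqP; rewrite -subr_eq0.
  suff : (x - y) ^+ (p ^ k) == 0 by rewrite expf_eq0 => /andP[].
  apply/eqP/(@addIr _ (y ^+ (p ^ k))).
  by rewrite add0r -exprDpk subrK eq_xy.
exists (invF inj_frob d) => x.
by rewrite -[RHS](trace_frobX k) exprMn (f_invF inj_frob).
Qed.

Lemma code_DP (l : nat) u : u \in code_D charFp l ->
  exists (a b c : F) (h : 'F_p), forall x,
    u x = tr (a * x ^+ (p ^ (3 * l) + 1) + b * x ^+ (p ^ l + 1) + c * x) + h.
Proof.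
by case/imsetP=> [[[[a b] c] h]] _ ->; exists a, b, c, h => x; rewrite ffunE.
Qed.

Lemma code_D_affine (l : nat) (s t : F) u :
  u \in code_D charFp l -> [ffun x => u (s * x + t)] \in code_D charFp l.
Proof.
case/code_DP=> a [b [c [h Du]]].
set P := (p ^ (3 * l))%N; set Q := (p ^ l)%N.
(* [e1] and [e2] turn the cross terms in [x ^+ P] and [x ^+ Q] of the expansion into linear ones. *)
have [e1 De1] := trace_adjoint_frobX (3 * l) (a * s ^+ P * t).
have [e2 De2] := trace_adjoint_frobX l (b * s ^+ Q * t).
have De w d x : tr (w + (d + e1 + e2) * x)
    = tr (w + d * x + a * s ^+ P * t * x ^+ P + b * s ^+ Q * t * x ^+ Q).
  by rewrite !mulrDl !addrA !(raddfD tr) /= De1 De2.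
apply/imsetP; exists (a * s ^+ (P + 1), b * s ^+ (Q + 1),
   c * s + a * s * t ^+ P + b * s * t ^+ Q + e1 + e2,
   h + tr (a * t ^+ (P + 1) + b * t ^+ (Q + 1) + c * t)) => //.
apply/ffunP=> x; rewrite !ffunE Du -/P -/Q De [h + _]addrC addrA -raddfD /=.
by congr (tr _ + h); rewrite !exprD !expr1 !exprDpk !exprMn -/P -/Q; ring.
Qed.

(** Around [z], a codeword is a constant plus an additive part plus a quadratic form, as
    [w ^+ (p ^ k + 1)] is a product of two additive maps. Pairing opposite signs cancels the
    additive part; [u z *+ 4] balances the constants. *)
Lemma code_D_parallelogram (l : nat) u (z x y : F) : u \in code_D charFp l ->
  u (z + (x + y)) + u (z - (x + y)) + u (z + (x - y)) + u (z - (x - y))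
    + u z *+ 4
  = (u (z + x) + u (z - x) + u (z + y) + u (z - y)) *+ 2.
Proof.
case/code_DP=> a [b [c [h Du]]]; rewrite !Du.
set P := (p ^ (3 * l))%N; set Q := (p ^ l)%N.
pose A w := a * w ^+ (P + 1) + b * w ^+ (Q + 1) + c * w.
have NP k w : (- w : F) ^+ (p ^ k) = - w ^+ (p ^ k).
  apply/eqP; rewrite -addr_eq0 -exprDpk addNr expr0n expn_eq0.
  by rewrite (gtn_eqF (prime_gt0 (pcharf_prime charFp))).
have E : A (z + (x + y)) + A (z - (x + y)) + A (z + (x - y)) + A (z - (x - y))
    + A z *+ 4 = (A (z + x) + A (z - x) + A (z + y) + A (z - y)) *+ 2.
  by rewrite /A !exprD !expr1 /P /Q !(exprDpk, NP); ring.
(* With [A] abstract, additivity splits the trace only between values of [A], not inside them. *)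
rewrite -!/(A _); move: A E => A /(congr1 tr).
rewrite !(raddfMn tr, raddfD tr) /= => trE.
(* The constant [h] occurs eight times on each side. *)
rewrite mulrnDl [RHS](_ : _ = (tr (A (z + x)) + tr (A (z - x)) + tr (A (z + y))
  + tr (A (z - y))) *+ 2 + h *+ 8); last by ring.
by rewrite -trE; ring.
Qed.

Lemma code_D_weight_gt1 (l : nat) u : odd p -> (3 < #|F|)%N ->
  u \in code_D charFp l -> (0 < weight u)%N -> (1 < weight u)%N.
Proof.
move=> p_odd F3 uD w0; rewrite ltn_neqAle w0 andbT eq_sym.
apply/negP=> /cards1P[z supp_u].
have u0 w : w != 0 -> u (z + w) = 0.
  move=> w_neq0; have neq_zw : z + w != z by rewrite -subr_eq0 addrC addKr.
  have /setP/(_ (z + w)) := supp_u.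
  by rewrite !inE (negPf neq_zw) => /negbFE/eqP.
(* Avoiding these three values makes [y], [1 + y] and [1 - y] nonzero. The parallelogram identity
   with sides [1] and [y] then has [z] as its only point in the support, and reduces to
   [u z *+ 4 = 0]. *)
pose r : seq F := [:: 0; 1; -1].
have [y] : exists y, y \notin r.
  apply/existsP; rewrite -negb_forall; apply/negP=> /forallP all_in.
  have: (#|F| <= #|r|)%N.
    by apply/subset_leq_card/subsetP=> y _; exact: all_in.
  by move/leq_trans=> /(_ _ (card_size _)); rewrite leqNgt F3.
rewrite !inE !negb_or => /and3P[y0 y1 yN1].
have s1 : 1 + y != 0 by rewrite addrC addr_eq0.
have s2 : 1 - y != 0 by rewrite subr_eq0 eq_sym.
have := code_D_parallelogram z 1 y uD.
rewrite !u0 ?oppr_eq0 ?oner_eq0 // !add0r mul0rn => /eqP.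
have uz : u z != 0 by have /setP/(_ z) := supp_u; rewrite !inE eqxx.
have p_pr := pcharf_prime charFp.
rewrite -mulr_natr mulf_eq0 (negPf uz) /= -(dvdn_pcharf (pchar_Fp p_pr)).
rewrite (_ : 4 = 2 ^ 2)%N // Euclid_dvdX // andbT dvdn_prime2 // => /eqP p2.
by move: p_odd; rewrite p2.
Qed.

End Code.

Theorem theorem8 (p m l : nat) (F : finFieldType) (charFp : p \in [pchar F])
    (p_prime : prime p) (p_odd : odd p) (m_ge6 : (6 <= m)%N)
    (cardF : #|F| = (p ^ m)%N)
    (l_bounds : (1 <= l <= m - 1)%N)
    (l_notin : (l%:R : rat) \notin
       [:: m%:R / 6; m%:R / 4; m%:R / 2; 3 * m%:R / 4; 5 * m%:R / 6])
    (m_neq : m <> (3 * gcdn m l)%N) :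
  forall i : nat, (0 < i)%N ->
    (exists2 u : {ffun F -> 'F_p}, u \in code_D charFp l & weight u = i) ->
    exists lambda : nat,
      is_2design (p ^ m) i lambda (weight_supports (code_D charFp l) i).
Proof.
move=> i i_gt0 [u uD wu]; rewrite -cardF.
(* This leaves room for a field element other than [0], [1] and [-1]. *)
have F3 : (3 < #|F|)%N.
  rewrite cardF; apply: (@leq_trans (2 ^ 6)) => //.
  apply: (@leq_trans (p ^ 6)); first by rewrite leq_exp2r // prime_gt1.
  by rewrite leq_exp2l // prime_gt1.
have affD := weight_supports_affine (i := i)
  (fun s t u _ => @code_D_affine F p charFp m cardF l s t u).
apply: (affine_invariant_2design affD (b0 := codeword_support u)).
- by move=> _ /imsetP[v + ->]; rewrite inE => /andP[_ /eqP].
- by apply: imset_f; rewrite inE uD wu eqxx.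
- by apply: (@code_D_weight_gt1 F p charFp l); rewrite ?wu.
Qed.
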